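(* For every integer $n\ge 0$, $\overline{p}_3(11n)\equiv (-1)^n r_7(n)\pmod{11}$.
   Context: $\overline{p}_3(n)$ denotes the number of overpartition triples of $n$ (triples of overpartitions whose parts together sum to $n$, where an overpartition is a partition in which the first occurrence of each distinct part may be overlined), with $\overline{p}_3(0)=1$; equivalently $\sum_{n\ge0}\overline{p}_3(n)q^n=\big((-q;q)_\infty/(q;q)_\infty\big)^3$, where $(a;q)_\infty=\prod_{n\ge0}(1-aq^n)$. For $k,n\ge0$, $r_k(n)$ denotes the number of $(x_1,\dots,x_k)\in\mathbb{Z}^k$ with $x_1^2+\cdots+x_k^2=n$ (so $r_7(0)=1$). *)

(* Defs.v *)
From HB Require Import structures.
From mathcomp Require Import all_boot all_order all_algebra finmap.
From mathcomp Require Import boolp classical_sets cardinality.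

Set Implicit Arguments.
Unset Strict Implicit.
Unset Printing Implicit Defensive.

Import Order.TTheory GRing.Theory Num.Theory.

Local Open Scope classical_set_scope.

(* An overpartition is the weakly decreasing sequence of its parts, each paired
   with a flag telling whether it is overlined. In such a sequence equal parts
   are consecutive, so a part is not the first occurrence of its value exactly
   when it equals the part just before it; then its flag must be false. *)
Definition overpart_rel : rel (nat * bool) :=
  [rel x y | (y.1 < x.1) || (y.1 == x.1) && ~~ y.2].

Definition is_overpartition (s : seq (nat * bool)) : bool :=
  all (fun x => 0 < x.1) s && sorted overpart_rel s.

Definition weight (s : seq (nat * bool)) : nat := sumn (unzip1 s).

Definition overpartition_triples (n : nat) :
    set (seq (nat * bool) * seq (nat * bool) * seq (nat * bool)) :=
  [set t | [/\ is_overpartition t.1.1, is_overpartition t.1.2,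
               is_overpartition t.2 &
               weight t.1.1 + weight t.1.2 + weight t.2 = n]].

(* [fset_set] returns the empty set on infinite sets; the finiteness lemmas
   below show that this default is never used. *)
Definition overp3 (n : nat) : nat := #|` fset_set (overpartition_triples n)|.

Definition sum_squares_reps (k n : nat) : set {ffun 'I_k -> int} :=
  [set x | (\sum_(i < k) x i ^+ 2 = n%:Z)%R].

Arguments sum_squares_reps : clear implicits.

Definition rsq (k n : nat) : nat := #|` fset_set (sum_squares_reps k n)|.

Lemma finite_overpartitions (n : nat) :
  finite_set [set s | is_overpartition s /\ weight s <= n].
Proof.
pose f (u : n.-bseq ('I_n.+1 * bool)) :=
  [seq (val x.1, x.2) | x <- u] : seq (nat * bool).
apply: (@sub_finite_set _ _ (f @` setT)); last first.
  exact/finite_image/finite_finset.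
move=> s /= [/andP[s_gt0 _] s_le].
have size_le : size s <= n.
  apply: leq_trans s_le; elim: s s_gt0 => //= x s IHs /andP[x_gt0 /IHs].
  by rewrite /weight /= -add1n; apply: leq_add.
have part_le x : x \in s -> x.1 <= n.
  move=> xs; apply: leq_trans s_le; elim: s xs {s_gt0 size_le} => //= y s IHs.
  rewrite inE /weight /= => /orP[/eqP->|/IHs]; first exact: leq_addr.
  by move/leq_trans; apply; apply: leq_addl.
pose g (x : nat * bool) : 'I_n.+1 * bool := (inord x.1, x.2).
have size_g : size (map g s) <= n by rewrite size_map.
exists (Bseq size_g) => //; rewrite /f /= -map_comp.
rewrite -[RHS]map_id; apply/eq_in_map => x xs /=.
by rewrite inordK ?ltnS ?part_le//; case: (x).
Qed.

Lemma finite_overpartition_triples (n : nat) :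
  finite_set (overpartition_triples n).
Proof.
have fin := finite_overpartitions n.
apply: sub_finite_set (finite_setX (finite_setX fin fin) fin).
move=> [[s t] u] /= [/= os ot ou <-].
split; [split|]; split=> //=; first by rewrite -addnA leq_addr.
  by rewrite -addnA addnCA leq_addr.
exact: leq_addl.
Qed.

Lemma finite_sum_squares_reps (k n : nat) : finite_set (sum_squares_reps k n).
Proof.
pose f (u : {ffun 'I_k -> 'I_n.+1 * bool}) : {ffun 'I_k -> int} :=
  [ffun i => ((-1) ^+ (u i).2 * (val (u i).1)%:Z)%R].
apply: (@sub_finite_set _ _ (f @` setT)); last first.
  exact/finite_image/finite_finset.
move=> x /= xn; exists [ffun i => (inord `|x i|%N, (x i < 0)%R)] => //.
apply/ffunP => i; rewrite !ffunE /= inordK; first by rewrite -intEsign.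
rewrite ltnS; have : (`|x i|%N ^ 2 <= n)%N.
  rewrite -lez_nat -xn (bigD1 i)//= -abszX gez0_abs ?sqr_ge0// lerDl.
  by apply: sumr_ge0 => j _; apply: sqr_ge0.
by case: `|x i|%N => // m; apply: leq_trans; rewrite -mulnn leq_pmulr.
Qed.

(* Main.v *)
(* Modulo X^(N+1), the overpartition series P = prod (1 + q^k)/(1 - q^k) is the
   inverse of phi = sum_j (-1)^j q^(j^2) (Gauss). Over F_11 this gives
   P^3 = P^11 phi^8, and P^11 = P(q^11) by Frobenius. By Jacobi's eight-square
   theorem the coefficient of q^n (n > 0) in phi^8 is
   16 sum_(b y = n) w(y) b^3 with w(y) = 15 for even y and -1 for odd y; modulo
   11 the divisors b that are multiples of 11 drop out, so the coefficients of
   q^(11 m) and of q^m in phi^8 agree. Hence the coefficient of q^(11 n) in P^3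
   is that of q^n in P phi^8 = phi^7, which is (-1)^n r_7(n).

   Jacobi's theorem follows from the fact that both phi^8 and its Lambert series
   satisfy q u' = - 16 S u, where S is the sum of a q^(a x) over a > 0 and odd
   x > 0. For phi this is the logarithmic derivative of the product formula; for
   the Lambert series it is a convolution identity, proved by Liouville's method
   of involutions on the solutions of a x + b y = n. *)
Require Import Defs.
From mathcomp Require Import all_boot all_order all_algebra finmap.
From mathcomp Require Import finfield.
From mathcomp Require Import boolp classical_sets cardinality.
From mathcomp Require Import zify ring.

Set Implicit Arguments.
Unset Strict Implicit.
Unset Printing Implicit Defensive.

Import Order.TTheory GRing.Theory Num.Theory.

Local Open Scope classical_set_scope.
Local Open Scope ring_scope.

(** * Liouville's convolution identity *)

Lemma sum_involution (T : eqType) (s : seq T) (A : pred T) (tau : T -> T)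
    (g : T -> int) :
  uniq s ->
  {in s, forall t, A t -> [/\ tau t \in s, A (tau t) & tau (tau t) = t]} ->
  \sum_(t <- s | A t) g (tau t) = \sum_(t <- s | A t) g t.
Proof.
move=> us tauP; rewrite -!(big_filter s) -(big_map tau predT g).
apply: perm_big; apply: uniq_perm; last first.
- move=> t; apply/mapP/idP => [[u]|].
    by rewrite mem_filter => /andP[Au us' ->]; rewrite mem_filter;
      have [-> ->] := tauP _ us' Au.
  rewrite mem_filter => /andP[At ts]; have [ts' At' tK] := tauP _ ts At.
  by exists (tau t); rewrite ?mem_filter ?At'.
- exact: filter_uniq.
rewrite map_inj_in_uniq ?filter_uniq// => t u.
rewrite !mem_filter => /andP[At ts] /andP[Au us'] tu.
by have [_ _ <-] := tauP _ ts At; have [_ _ <-] := tauP _ us' Au; rewrite tu.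
Qed.

(** Every solution of a x = n in positive integers lies here once n <= N, so [N] acts as a
    truncation bound. *)
Definition box (N : nat) : seq (nat * nat) :=
  [seq (a, x) | a <- iota 1 N, x <- iota 1 N].

Lemma mem_box N u : (u \in box N) = (0 < u.1 <= N)%N && (0 < u.2 <= N)%N.
Proof.
apply/allpairsP/idP => [[[a x] /= [+ + ->]]|]; rewrite ?mem_iota ?add1n ?ltnS.
  by move=> -> ->.
case: u => a x /= /andP[Ha Hx]; exists (a, x).
by rewrite !mem_iota !add1n !ltnS.
Qed.

Lemma box_uniq N : uniq (box N).
Proof. by apply: allpairs_uniq; rewrite ?iota_uniq// => -[? ?] [? ?]. Qed.

Definition quads (N : nat) : seq ((nat * nat) * (nat * nat)) :=
  [seq (u, v) | u <- box N, v <- box N].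

Lemma mem_quads N t : (t \in quads N) = (t.1 \in box N) && (t.2 \in box N).
Proof.
apply/allpairsP/idP => [[[u v] /= [Hu Hv ->]]|/andP[Hu Hv]].
  by rewrite Hu Hv.
by exists t; split=> //; case: t {Hu Hv}.
Qed.

Lemma quads_uniq N : uniq (quads N).
Proof. by apply: allpairs_uniq; rewrite ?box_uniq// => -[? ?] [? ?]. Qed.

Definition qnorm (t : (nat * nat) * (nat * nat)) : nat :=
  t.1.1 * t.1.2 + t.2.1 * t.2.2.

Lemma mem_quads_norm N n t : (n <= N)%N -> qnorm t = n ->
  (t \in quads N) = [&& 0 < t.1.1, 0 < t.1.2, 0 < t.2.1 & 0 < t.2.2]%N.
Proof.
case: t => [[a x] [b y]]; rewrite /qnorm mem_quads !mem_box /= => nN tn.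
apply/idP/idP; first by case/andP=> /andP[/andP[-> _] /andP[-> _]] /andP[/andP[-> _] /andP[-> _]].
by case/and4P=> *; apply/andP; split; apply/andP; split; nia.
Qed.

Definition cube_weight (y : nat) : int := if odd y then -1 else 15.
Definition odd_term (u : nat * nat) : int := if odd u.2 then u.1%:Z else 0.
Definition cube_term (v : nat * nat) : int := cube_weight v.2 * v.1%:Z ^+ 3.

(* This polynomial solves the linear system saying that [liou] is invariant under
   [swap1], changes sign under [tau], and has the same average over the group
   generated by [swap1] and [swap2] as 16 times [conv_term]. *)
Definition liou_half (ox oy : bool) (a b : int) : int :=
  match ox, oy with
  | false, false => 0
  | false, true => b ^+ 4 - 30 * a ^+ 2 * b ^+ 2 + 60 * a ^+ 3 * b - 30 * a ^+ 4
  | true, false => a ^+ 4 - 30 * a ^+ 2 * b ^+ 2 + 60 * a * b ^+ 3 - 30 * b ^+ 4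
  | true, true => a ^+ 4 + b ^+ 4 - 4 * a * b ^+ 3 - 4 * a ^+ 3 * b
                  - 24 * a ^+ 2 * b ^+ 2
  end.

Definition liou (t : (nat * nat) * (nat * nat)) : int :=
  let: ((a, x), (b, y)) := t in
  liou_half (odd x) (odd y) a%:Z b%:Z - liou_half (odd a) (odd b) x%:Z (- y%:Z).

Definition swap1 (t : (nat * nat) * (nat * nat)) := (t.2, t.1).
Definition swap2 (t : (nat * nat) * (nat * nat)) :=
  ((t.1.2, t.1.1), (t.2.2, t.2.1)).
(** It comes from a x + b y = (x + y) b + x (a - b), so it preserves [qnorm] when b < a; its image
    satisfies the same condition, x < x + y, because y is positive. *)
Definition tau (t : (nat * nat) * (nat * nat)) :=
  ((t.1.2 + t.2.2, t.2.1), (t.1.2, t.1.1 - t.2.1))%N.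

Lemma liou_swap1 t : liou (swap1 t) = liou t.
Proof.
case: t => [[a x] [b y]]; rewrite /liou /swap1 /=.
by case: (odd a); case: (odd b); case: (odd x); case: (odd y); rewrite /liou_half; ring.
Qed.

(** Put T(u, v) = (u - v, u). Then [tau] turns (a, b) into T(x, -y), and (x, -y) into the preimage
    of (a, b) under T. The family [liou_half] is invariant under T when its parities (p, q) become
    (q, p + q), so the two halves of [liou] trade places. *)
Lemma liou_tau t : (t.2.1 < t.1.1)%N -> liou (tau t) = - liou t.
Proof.
case: t => [[a x] [b y]]; rewrite /liou /tau /= => ba.
rewrite !(oddD, oddB)// 1?ltnW// PoszD -subzn 1?ltnW//.
by case: (odd a); case: (odd b); case: (odd x); case: (odd y); rewrite /liou_half /=; ring.
Qed.

Definition conv_term (t : (nat * nat) * (nat * nat)) : int := odd_term t.1 * cube_term t.2.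

Lemma liou_conv_term t :
  liou t + liou (swap1 t) + liou (swap2 t) + liou (swap1 (swap2 t)) =
  16 * (conv_term t + conv_term (swap1 t) + conv_term (swap2 t) + conv_term (swap1 (swap2 t))).
Proof.
case: t => [[a x] [b y]]; rewrite /liou /conv_term /odd_term /cube_term /cube_weight /swap1 /swap2 /=.
by case: (odd a); case: (odd b); case: (odd x); case: (odd y); rewrite /liou_half; ring.
Qed.

(* Off the diagonal [t.1.1 = t.2.1] the sum of [liou] vanishes: [tau] is an
   involution of the part [t.2.1 < t.1.1] that changes its sign, and [swap1]
   exchanges this part with [t.1.1 < t.2.1]. *)
Lemma sum_liou_diag N n : (n <= N)%N ->
  16 * \sum_(t <- quads N | qnorm t == n) conv_term t =
  \sum_(t <- quads N | (qnorm t == n) && (t.1.1 == t.2.1)) liou t.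
Proof.
move=> nN.
have S1 (g : _ -> int) : \sum_(t <- quads N | qnorm t == n) g (swap1 t) =
            \sum_(t <- quads N | qnorm t == n) g t.
  apply: (@sum_involution _ (quads N) (fun t => qnorm t == n) swap1 g); first exact: quads_uniq.
  by move=> [u v]; rewrite !mem_quads /qnorm /= => /andP[-> ->] /eqP<-; rewrite addnC eqxx.
have S2 (g : _ -> int) : \sum_(t <- quads N | qnorm t == n) g (swap2 t) =
            \sum_(t <- quads N | qnorm t == n) g t.
  apply: (@sum_involution _ (quads N) (fun t => qnorm t == n) swap2 g); first exact: quads_uniq.
  move=> [[a x] [b y]]; rewrite !mem_quads !mem_box /qnorm /=.
  move=> /andP[/andP[-> ->] /andP[-> ->]] /eqP<-.
  by rewrite mulnC [(y * b)%N]mulnC eqxx.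
have sumG : \sum_(t <- quads N | qnorm t == n) liou t =
            16 * \sum_(t <- quads N | qnorm t == n) conv_term t.
  (* The two swaps generate a group of order four that preserves the norm, so replacing [g] by its
     sum over the group multiplies the total by 4. *)
  have V4 (g : _ -> int) : \sum_(t <- quads N | qnorm t == n)
      (g t + g (swap1 t) + g (swap2 t) + g (swap1 (swap2 t))) =
      4 * \sum_(t <- quads N | qnorm t == n) g t.
    rewrite !big_split /= S1 S2 (S2 (fun t => g (swap1 t))) S1; ring.
  apply: (@mulfI _ 4) => //; rewrite mulrCA -!V4 mulr_sumr.
  by apply: eq_bigr => t _; exact: liou_conv_term.
rewrite -sumG (bigID (fun t => t.1.1 == t.2.1)) /= -[RHS]addr0; congr (_ + _).
rewrite (bigID (fun t => t.2.1 < t.1.1)%N) /=.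
pose A t := [&& qnorm t == n & (t.2.1 < t.1.1)%N].
have sA : \sum_(t <- quads N | A t) liou t = 0.
  have : \sum_(t <- quads N | A t) liou (tau t) = \sum_(t <- quads N | A t) liou t.
    apply: (@sum_involution _ (quads N) A tau liou); first exact: quads_uniq.
    move=> [[a x] [b y]] tq /andP[/eqP tn ba].
    move: tq; rewrite (mem_quads_norm nN tn) => tq.
    have tn' : qnorm (tau ((a, x), (b, y))) = n.
      by move: tn tq ba; rewrite /qnorm /=; nia.
    rewrite (mem_quads_norm nN tn') /A tn' eqxx /=; move: tq ba => /=.
    by split; [lia|lia|rewrite /tau /=; congr (_, _, (_, _)); lia].
  rewrite (eq_bigr (fun t => - liou t)) ?sumrN; last first.
    by move=> t /andP[_ ?]; exact: liou_tau.
  by move: (\sum_(t <- _ | _) _) => z; lia.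
rewrite (eq_bigl A) ?sA ?add0r; last first.
  by move=> t; rewrite /A; case: ltngtP; rewrite ?andbT ?andbF.
rewrite -(big_filter_cond) -[RHS]sA.
rewrite -big_filter.
have -> : \sum_(t <- quads N | A t) liou t = \sum_(t <- quads N | A t) liou (swap1 t).
  by apply: eq_bigr => t _; rewrite liou_swap1.
rewrite -(big_filter (quads N)) -(big_map swap1 predT).
apply: perm_big; apply: uniq_perm.
- by rewrite !filter_uniq ?quads_uniq.
- rewrite map_inj_uniq ?filter_uniq ?quads_uniq// => -[? ?] [? ?] [-> ->] //.
move=> [u v]; rewrite -[in RHS](_ : swap1 (v, u) = (u, v))// mem_map; last first.
  by move=> [? ?] [? ?] [-> ->].
rewrite !mem_filter !mem_quads /A /qnorm /= addnC [(u \in _) && _]andbC.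
by case: ltngtP; rewrite ?andbT ?andbF.
Qed.

(** At equal arguments [liou_half] is a^4 times 0 (both parities even), 1 (opposite) or -30 (both
    odd). For odd m only the value 1 occurs; for even m the value -30 occurs once for each odd x <=
    k. *)
Lemma sum_liou_half_diag (a : int) (m k : nat) : (k < m)%N ->
  \sum_(1 <= x < k.+1) liou_half (odd x) (odd (m - x)) a a =
  a ^+ 4 * (if odd m then k%:Z else - 30 * (uphalf k)%:Z).
Proof.
elim: k => [|k IHk] km; first by rewrite big_geq//; case: odd; rewrite /=; ring.
rewrite big_nat_recr//= IHk 1?ltnW// oddB 1?ltnW// /liou_half /= uphalf_half.
by case: (odd m); case: (odd k); rewrite /= ?add0n ?add1n; lia || ring.
Qed.

(** With y = m - x the summand is (x + y)^4 - 30 x^2 y^2 = m^4 - 30 x^2 (m - x)^2; the closed form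
    combines the sums of squares, cubes and fourth powers up to k. *)
Lemma sum_liou_half_opp (m k : nat) : (k < m)%N ->
  \sum_(1 <= x < k.+1) liou_half true true x%:Z (- (m - x)%:Z) =
  (k%:Z * m%:Z ^+ 4 - (m%:Z ^+ 2 * 5 * k%:Z * (k%:Z + 1) * (2 * k%:Z + 1)
   - 15 * m%:Z * k%:Z ^+ 2 * (k%:Z + 1) ^+ 2
   + k%:Z * (k%:Z + 1) * (2 * k%:Z + 1) * (3 * k%:Z ^+ 2 + 3 * k%:Z - 1))).
Proof.
elim: k => [|k IHk] km; first by rewrite big_geq//; ring.
rewrite big_nat_recr//= IHk 1?ltnW// -subzn 1?ltnW// /liou_half intS; ring.
Qed.

(** The case k = m - 1 of the two preceding sums. The second collapses because 30 times the sum of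
    x^2 (m - x)^2 over 0 < x < m is m^5 - m. *)
Lemma sum_liou_inner (a m : nat) : (0 < m)%N ->
  \sum_(1 <= x < m) liou ((a, x), (a, (m - x)%N)) =
  a%:Z ^+ 4 * (if odd m then m%:Z - 1 else - 15 * m%:Z)
  + (if odd a then m%:Z ^+ 4 - m%:Z else 0).
Proof.
case: m => // k _; rewrite sumrB sum_liou_half_diag//; congr (_ + _).
  rewrite uphalf_half /=; have := odd_double_half k.
  by case: (odd k) => /= h; congr (_ * _); lia.
case: (odd a); last by rewrite big1 ?oppr0// => *; rewrite /liou_half.
by rewrite sum_liou_half_opp// intS; ring.
Qed.

(** A solution of a x + a y = n is a factorization n = a m together with a splitting m = x + y. *)
Lemma sum_liou_diag_box N n : (n <= N)%N ->
  \sum_(t <- quads N | (qnorm t == n) && (t.1.1 == t.2.1)) liou t =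
  \sum_(u <- box N | (u.1 * u.2 == n)%N)
    \sum_(1 <= x < u.2) liou ((u.1, x), (u.1, (u.2 - x)%N)).
Proof.
move=> nN; rewrite -big_filter -[RHS]big_filter.
pose h (u : nat * nat) x := ((u.1, x), (u.1, (u.2 - x)%N)).
transitivity (\sum_(t <- [seq h u x | u <- [seq u <- box N | (u.1 * u.2 == n)%N],
                              x <- index_iota 1 u.2]) liou t); last first.
  by rewrite big_allpairs_dep.
apply: perm_big; apply: uniq_perm; first by rewrite filter_uniq ?quads_uniq.
  apply: allpairs_uniq_dep => [|u _|].
  - by rewrite filter_uniq ?box_uniq.
  - exact: iota_uniq.
  move=> p q /allpairsPdep[u [x [_ + ->]]] /allpairsPdep[v [y [_ + ->]]].
  rewrite !mem_index_iota /h /= => /andP[x0 xu] /andP[y0 yv] [uv xy _ e].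
  case: u v uv xu yv e => u1 u2 [v1 v2] /= -> xu yv e; rewrite xy.
  by have -> : u2 = v2 by lia.
move=> [[a x] [b y]]; rewrite mem_filter.
apply/idP/allpairsPdep.
  rewrite /qnorm mem_quads !mem_box /= => /andP[/andP[/eqP tn /eqP ab]].
  rewrite -{}ab in tn *.
  move=> /andP[/andP[/andP[a0 aN] /andP[x0 xN]] /andP[_ /andP[y0 yN]]].
  exists (a, (x + y)%N), x; split; rewrite /h /=.
  - rewrite mem_filter mem_box /= mulnDr tn eqxx a0 aN addn_gt0 x0 /=.
    by nia.
  - by rewrite mem_index_iota x0 /=; lia.
  - by rewrite addKn.
move=> [[a' m] [x' [+ +]]]; rewrite mem_filter mem_box mem_index_iota /h /=.
move=> /andP[/eqP amn /andP[/andP[a0 aN] /andP[m0 mN]]] /andP[x0 xm].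
move=> [-> -> -> ->]; rewrite /qnorm mem_quads !mem_box /= eqxx andbT.
rewrite -mulnDr (subnKC (ltnW xm)) amn eqxx a0 aN x0 /= subn_gt0 xm /=.
by lia.
Qed.

Lemma box_swap N (P : pred (nat * nat)) (g : nat * nat -> int) :
  \sum_(u <- box N | P u) g u =
  \sum_(u <- box N | P (u.2, u.1)) g (u.2, u.1).
Proof.
rewrite -big_filter -[RHS]big_filter -(big_map (fun u => (u.2, u.1)) predT).
apply: perm_big; apply: uniq_perm; first by rewrite filter_uniq ?box_uniq.
  rewrite map_inj_uniq ?filter_uniq ?box_uniq//.
  by move=> [? ?] [? ?] [-> ->].
move=> [a x]; rewrite -[in RHS](_ : ((x, a).2, (x, a).1) = (a, x))//.
rewrite (mem_map (f := fun u => (u.2, u.1))) ?mem_filter ?mem_box /= 1?[X in _ && X]andbC//.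
by move=> [? ?] [? ?] [-> ->].
Qed.

Lemma lambert_recurrence N n : (n <= N)%N ->
  n%:Z * (\sum_(u <- box N | (u.1 * u.2 == n)%N) cube_term u)
  + \sum_(u <- box N | (u.1 * u.2 == n)%N) odd_term u
  + 16 * \sum_(t <- quads N | qnorm t == n) odd_term t.1 * cube_term t.2 = 0.
Proof.
move=> nN; rewrite sum_liou_diag// sum_liou_diag_box//.
(* For n = a m the three contributions of (a, m) add up to F(a, m) - F(m, a), which cancels under
   the exchange of a and m. *)
pose F (u : nat * nat) : int :=
  if odd u.2 then u.1%:Z - u.1%:Z ^+ 4 else 0.
have swapF : \sum_(u <- box N | (u.1 * u.2 == n)%N) F u =
    \sum_(u <- box N | (u.1 * u.2 == n)%N) F (u.2, u.1).
  by rewrite box_swap; apply: eq_bigl => u; rewrite mulnC.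
rewrite mulr_sumr -!big_split /= big_seq_cond.
transitivity (\sum_(u <- box N | (u.1 * u.2 == n)%N) (F u - F (u.2, u.1))).
  rewrite [RHS]big_seq_cond; apply: eq_bigr => -[a m] /andP[].
  rewrite mem_box /= => /andP[_ /andP[m0 _]] /eqP <-.
  rewrite sum_liou_inner// /F /cube_term /odd_term /cube_weight /= PoszM.
  by case: (odd m); case: (odd a); ring.
by rewrite sumrB swapF subrr.
Qed.

(** * Power series modulo X^(N+1) *)

Definition eqX (R : nzRingType) (N : nat) (p q : {poly R}) : Prop :=
  forall i, (i <= N)%N -> p`_i = q`_i.

Lemma eqX_refl (R : nzRingType) N (p : {poly R}) : eqX N p p.
Proof. by []. Qed.

Lemma eqX_sym (R : nzRingType) N (p q : {poly R}) : eqX N p q -> eqX N q p.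
Proof. by move=> pq i /pq. Qed.

Lemma eqX_trans (R : nzRingType) N (q p r : {poly R}) :
  eqX N p q -> eqX N q r -> eqX N p r.
Proof. by move=> pq qr i iN; rewrite pq// qr. Qed.

Lemma eqXD (R : nzRingType) N (p q p' q' : {poly R}) :
  eqX N p q -> eqX N p' q' -> eqX N (p + p') (q + q').
Proof. by move=> pq pq' i iN; rewrite !coefD pq// pq'. Qed.

Lemma eqXN (R : nzRingType) N (p q : {poly R}) :
  eqX N p q -> eqX N (- p) (- q).
Proof. by move=> pq i iN; rewrite !coefN pq. Qed.

Lemma eqXM (R : nzRingType) N (p q p' q' : {poly R}) :
  eqX N p q -> eqX N p' q' -> eqX N (p * p') (q * q').
Proof.
move=> pq pq' i iN; rewrite !coefM; apply: eq_bigr => -[j ji] _ /=.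
by rewrite ltnS in ji; rewrite pq ?pq'// ?(leq_trans _ iN)// leq_subr.
Qed.

Lemma eqXMl (R : nzRingType) N (r p q : {poly R}) :
  eqX N p q -> eqX N (r * p) (r * q).
Proof. exact: eqXM. Qed.

Lemma eqXX (R : nzRingType) N k (p q : {poly R}) :
  eqX N p q -> eqX N (p ^+ k) (q ^+ k).
Proof. by move=> pq; elim: k => // k IHk; rewrite !exprS; apply: eqXM. Qed.

Lemma eqX_sum (R : nzRingType) N (I : Type) (s : seq I) (p q : I -> {poly R}) :
  (forall i, eqX N (p i) (q i)) ->
  eqX N (\sum_(i <- s) p i) (\sum_(i <- s) q i).
Proof. by move=> pq i iN; rewrite !coef_sum; apply: eq_bigr => j _; apply: pq. Qed.

Lemma eqX_Xn0 (R : nzRingType) N n (p : {poly R}) :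
  (N < n)%N -> eqX N (p * 'X^n) 0.
Proof. by move=> Nn i iN; rewrite coefMXn coef0 (leq_ltn_trans iN Nn). Qed.

Lemma eqX_cancel (R : nzRingType) N (r p q : {poly R}) : r`_0 = 1 ->
  eqX N (r * p) (r * q) -> eqX N p q.
Proof.
move=> r0 rpq; elim/ltn_ind => i IHi iN; have := rpq i iN.
rewrite !coefM !big_ord_recl /= subn0 r0 !mul1r => /eqP.
rewrite (eq_bigr (fun j : 'I_i => r`_(bump 0 j) * q`_(i - bump 0 j))).
  by move/eqP/addIr.
move=> j _; congr (_ * _); have := ltn_ord j; rewrite /bump leq0n add1n => ji.
by apply: IHi; rewrite ?(leq_trans (leq_subr _ _))// -subSn// subSS leq_subr.
Qed.

(** The Euler operator X d/dX: unlike d/dX it loses no precision modulo X^(N+1). *)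
Definition qderiv (R : nzRingType) (p : {poly R}) : {poly R} := 'X * p^`().

Lemma coef_qderiv (R : nzRingType) (p : {poly R}) i : (qderiv p)`_i = p`_i *+ i.
Proof. by rewrite coefXM coef_deriv; case: i => [|i] /=; rewrite ?mulr0n. Qed.

Lemma eqX_qderiv (R : nzRingType) N (p q : {poly R}) :
  eqX N p q -> eqX N (qderiv p) (qderiv q).
Proof. by move=> pq i iN; rewrite !coef_qderiv pq. Qed.

Lemma qderivM (R : comNzRingType) (p q : {poly R}) :
  qderiv (p * q) = qderiv p * q + p * qderiv q.
Proof. by rewrite /qderiv derivM; ring. Qed.

Lemma qderivX (R : comNzRingType) (p : {poly R}) n :
  qderiv (p ^+ n.+1) = n.+1%:R * p ^+ n * qderiv p.
Proof.
elim: n => [|n IHn]; first by rewrite expr1 expr0; ring.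
by rewrite exprS qderivM IHn -[n.+2]addn1 natrD [p ^+ n.+1]exprS; ring.
Qed.

Lemma qderiv_Xn (R : comNzRingType) n : qderiv ('X^n) = n%:R * 'X^n :> {poly R}.
Proof.
apply/polyP => i; rewrite coef_qderiv mulr_natl coefMn coefXn.
by case: eqP => [->|] //=; rewrite !mul0rn.
Qed.

(** As S has no constant term, coefficient i + 1 of S u involves only the coefficients of u up to i,
    and it equals i + 1 times the next one. *)
Lemma eqX_ode N (S u v : {poly int}) : S`_0 = 0 -> u`_0 = v`_0 ->
  eqX N (qderiv u) (S * u) -> eqX N (qderiv v) (S * v) -> eqX N u v.
Proof.
move=> S0 uv0 odeu odev; elim/ltn_ind => -[|i] IHi iN //.
apply: (@mulIf _ i.+1%:R); rewrite ?pnatr_eq0// !mulr_natr -!coef_qderiv.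
rewrite odeu// odev// !coefM 2!(@big_ord_recl _ _ _ i.+1) /= S0 !mul0r !add0r.
apply: eq_bigr => j _; congr (_ * _); have := ltn_ord j.
rewrite /bump leq0n add1n subSS => ji.
by apply: IHi; [rewrite ltnS leq_subr|apply: leq_trans (ltnW iN); apply: leq_subr].
Qed.

(** * Gauss's product formula for phi *)

Definition theta_neg (R : comNzRingType) N : {poly R} :=
  1 + \sum_(1 <= j < N.+1) 2 * (-1) ^+ j * 'X^(j ^ 2).

Definition prodp (R : comNzRingType) (i j : nat) : {poly R} := \prod_(i <= k < j) (1 + 'X^k).
Definition prodm (R : comNzRingType) (i j : nat) : {poly R} := \prod_(i <= k < j) (1 - 'X^k).

(** The terms of a finite, exact form of Gauss's identity; term s is divisible by X^(s (n+1)). *)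
Definition gauss_term (R : comNzRingType) n s : {poly R} :=
  (if s == 0%N then 1 else 2) * (-1) ^+ s * prodp R 1 s * 'X^(s * n.+1)
  * prodm R s.+1 n.+1.

(** A telescoping certificate for the recurrence in n. At j = n + 1 the last product is empty, and
    adding the new term s = n + 1 gives 2 (-1)^(n+1) X^((n+1)^2) times [prodp R 1 n.+2], the
    contribution of the new theta term. *)
Lemma gauss_term_telescope (R : comNzRingType) n j : (0 < j <= n.+1)%N ->
  \sum_(0 <= s < j) (gauss_term R n.+1 s - (1 + 'X^(n.+1)) * gauss_term R n s) =
  2 * (-1) ^+ j * prodp R 1 j * 'X^(j * n.+1) * prodm R j n.+1.
Proof.
(* The induction starts at j = 1, since the term s = 0 carries the factor 1 instead of 2. *)
elim: j => // -[|j] IHj /andP[_ jn].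
  rewrite big_nat1 /gauss_term /= /prodp big_geq// !mul0n !expr0 expr1 mul1n.
  by rewrite /prodm (@big_nat_recr _ _ _ n.+1)//=; ring.
rewrite big_nat_recr//= IHj ?(ltnW jn)// /gauss_term /=.
rewrite /prodm (@big_nat_recr _ _ _ n.+1 j.+2)//= (@big_ltn _ _ _ j.+1)//.
rewrite /prodp (@big_nat_recr _ _ _ j.+1)//=.
rewrite (mulnS j.+1 n.+1) (mulSn j.+1 n.+1) !(exprD _ _ (j.+1 * n.+1)%N).
by rewrite [_ ^+ j.+2]exprS; ring.
Qed.

(* Modulo X^(n+1) only the term s = 0 of the right-hand side survives, which gives
   Gauss's product for [theta_neg]. *)
Lemma gauss_finite (R : comNzRingType) n :
  theta_neg R n * prodp R 1 n.+1 = \sum_(0 <= s < n.+1) gauss_term R n s.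
Proof.
elim: n => [|n IHn].
  rewrite big_nat1 /gauss_term /theta_neg /prodp /prodm !big_geq// mul0n !expr0 /=.
  by ring.
have := @gauss_term_telescope R n n.+1; rewrite leqnn => /(_ isT).
rewrite sumrB -mulr_sumr -IHn => /eqP; rewrite subr_eq => /eqP E.
rewrite big_nat_recr//= E /gauss_term /theta_neg [in LHS]big_nat_recr//= /prodp.
rewrite (@big_nat_recr _ _ _ n.+1)//= /prodm !(big_geq (leqnn _)).
by rewrite (mulnS n.+1 n.+1) exprD -mulnn; ring.
Qed.

Lemma theta_neg_prod (R : comNzRingType) N : eqX N (theta_neg R N * prodp R 1 N.+1) (prodm R 1 N.+1).
Proof.
rewrite gauss_finite big_nat_recl//= -[X in eqX _ _ X]addr0; apply: eqXD.
  by rewrite /gauss_term /prodp big_geq// mul0n !expr0 !mul1r => i iN.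
apply: (@eqX_trans _ _ (\sum_(0 <= s < N) 0)); last by rewrite big1_eq.
apply: eqX_sum => s; rewrite /gauss_term mulrAC; apply: eqX_Xn0.
by rewrite mulSn ltnS leq_addr.
Qed.

(** * Jacobi's eight-square theorem *)

Lemma coef0_prodp (R : comNzRingType) n : (prodp R 1 n.+1)`_0 = 1.
Proof.
elim: n => [|n IHn]; first by rewrite /prodp big_geq// coef1.
rewrite /prodp big_nat_recr//= -/(prodp R 1 n.+1) coef0M IHn mul1r.
by rewrite coefD coef1 coefXn addr0.
Qed.

Lemma coef0_prodm (R : comNzRingType) n : (prodm R 1 n.+1)`_0 = 1.
Proof.
elim: n => [|n IHn]; first by rewrite /prodm big_geq// coef1.
rewrite /prodm big_nat_recr//= -/(prodm R 1 n.+1) coef0M IHn mul1r.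
by rewrite coefB coef1 coefXn subr0.
Qed.

Definition lambert_row (N k : nat) : {poly int} :=
  \sum_(1 <= x < N.+1) (if odd x then k%:R * 'X^(k * x) else 0).

(** A geometric series of ratio X^(2(k+1)), cut off with a remainder of order above N. *)
Lemma lambert_rowE N k : eqX N (lambert_row N k.+1 * (1 - 'X^(k.+1 * 2))) (k.+1%:R * 'X^(k.+1)).
Proof.
have telescope M : \sum_(1 <= x < M.+1) (if odd x then 'X^(k.+1 * x) else 0)
    * (1 - 'X^(k.+1 * 2)) =
    'X^(k.+1) - 'X^(k.+1 * (uphalf M).*2.+1) :> {poly int}.
  elim: M => [|M IHM]; first by rewrite big_geq//= muln1 subrr.
  rewrite big_nat_recr//= {}IHM.
  have := odd_double_half M; rewrite uphalf_half.
  case: (odd M) => /= [_|]; first by rewrite mul0r addr0.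
  rewrite !add0n => <-; rewrite doubleS doubleK -[in RHS]addn2 mulnDr.
  by rewrite [in RHS]exprD mulrBr mulr1; ring.
have -> : lambert_row N k.+1 * (1 - 'X^(k.+1 * 2)) =
    k.+1%:R * ('X^(k.+1) - 'X^(k.+1 * (uphalf N).*2.+1)).
  rewrite -telescope mulr_sumr /lambert_row mulr_suml; apply: eq_bigr => x _.
  by case: odd; rewrite ?mul0r ?mulr0// mulrA.
rewrite -[X in eqX _ _ X]addr0 mulrBr; apply: eqXD => //.
rewrite -mulNr; apply: eqX_Xn0; rewrite uphalf_half.
have := odd_double_half N; case: (odd N); lia.
Qed.

(** The logarithmic derivative of A / B with denominators cleared: the factor k contributes k q^k/(1
    + q^k) + k q^k/(1 - q^k) = 2 k q^k/(1 - q^(2k)). *)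
Lemma qderiv_prod N n :
  let A := prodp int 1 n.+1 in let B := prodm int 1 n.+1 in
  eqX N (qderiv A * B - A * qderiv B)
        (2 * (\sum_(1 <= k < n.+1) lambert_row N k) * (A * B)).
Proof.
elim: n => [|n IHn] /=.
  by rewrite /prodp /prodm !big_geq// /qderiv -polyC1 derivC !mulr0 !mul0r subr0.
set A := prodp int 1 n.+1 in IHn *; set B := prodm int 1 n.+1 in IHn *.
set L := \sum_(1 <= k < n.+1) _ in IHn *.
have -> : prodp int 1 n.+2 = A * (1 + 'X^(n.+1)) by rewrite /prodp big_nat_recr.
have -> : prodm int 1 n.+2 = B * (1 - 'X^(n.+1)) by rewrite /prodm big_nat_recr.
rewrite big_nat_recr//= -/L !qderivM.
have t1 : qderiv (1 + 'X^(n.+1)) = n.+1%:R * 'X^(n.+1) :> {poly int}.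
  by rewrite -qderiv_Xn /qderiv derivD -polyC1 derivC add0r.
have t2 : qderiv (1 - 'X^(n.+1)) = - (n.+1%:R * 'X^(n.+1)) :> {poly int}.
  by rewrite -qderiv_Xn /qderiv derivB -polyC1 derivC sub0r mulrN.
rewrite t1 t2; set Y := 'X^(n.+1).
have -> : (qderiv A * (1 + Y) + A * (n.+1%:R * Y)) * (B * (1 - Y)) -
    A * (1 + Y) * (qderiv B * (1 - Y) + B * - (n.+1%:R * Y)) =
    (1 + Y) * (1 - Y) * (qderiv A * B - A * qderiv B)
    + 2 * (A * B) * (n.+1%:R * Y) by ring.
have -> : 2 * (L + lambert_row N n.+1) * (A * (1 + Y) * (B * (1 - Y))) =
    (1 + Y) * (1 - Y) * (2 * L * (A * B)) +
    2 * (A * B) * (lambert_row N n.+1 * (1 - Y * Y)) by ring.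
apply: eqXD; first exact: eqXMl.
apply/eqXMl/eqX_sym; rewrite /Y -exprD addnn -muln2; exact: lambert_rowE.
Qed.

Definition lambert (f : nat * nat -> int) (N : nat) : {poly int} :=
  \sum_(u <- box N) (f u)%:P * 'X^(u.1 * u.2).

Lemma coef_lambert f N n :
  (lambert f N)`_n = \sum_(u <- box N | (u.1 * u.2 == n)%N) f u.
Proof.
rewrite /lambert coef_sum [RHS]big_mkcond; apply: eq_bigr => u _.
by rewrite coefCM coefXn eq_sym; case: eqP => _; rewrite ?mulr1 ?mulr0.
Qed.

Lemma coef_lambertM f g N n :
  (lambert f N * lambert g N)`_n =
  \sum_(t <- quads N | qnorm t == n) f t.1 * g t.2.
Proof.
rewrite /lambert big_distrlr /= [RHS]big_mkcond /= [RHS]big_allpairs coef_sum.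
apply: eq_bigr => u _; rewrite coef_sum; apply: eq_bigr => v _.
rewrite mulrACA -polyCM -exprD coefCM coefXn eq_sym /qnorm /=.
by case: eqP => _; rewrite ?mulr1 ?mulr0.
Qed.

Lemma sum_lambert_row N : \sum_(1 <= k < N.+1) lambert_row N k = lambert odd_term N.
Proof.
rewrite /lambert big_allpairs /index_iota subn1 /=; apply: eq_bigr => k _.
rewrite /lambert_row /index_iota subn1; apply: eq_bigr => x _; rewrite /odd_term /=.
by case: odd; rewrite ?mul0r// -[k%:Z]natz polyC_natr.
Qed.

Lemma coef0_lambert f N : (lambert f N)`_0 = 0.
Proof.
rewrite coef_lambert big_seq_cond big1// => -[a x] /andP[].
by rewrite mem_box muln_eq0 /= => /andP[/andP[a0 _] /andP[x0 _]]; lia.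
Qed.

(** Logarithmic differentiation of phi A = B. The identity is multiplied by A B, which can be
    cancelled because its constant term is 1. *)
Lemma qderiv_theta_neg N :
  eqX N (qderiv (theta_neg int N)) (- 2 * lambert odd_term N * theta_neg int N).
Proof.
set ph := theta_neg int N; pose A := prodp int 1 N.+1; pose B := prodm int 1 N.+1.
have phA : eqX N (ph * A) B by exact: theta_neg_prod.
have tAB : eqX N (qderiv A * B - A * qderiv B) (2 * lambert odd_term N * (A * B)).
  by rewrite -sum_lambert_row; exact: qderiv_prod.
apply: (@eqX_cancel _ _ (A * B)); first by rewrite coef0M coef0_prodp coef0_prodm mulr1.
have tphA : eqX N (qderiv ph * A + ph * qderiv A) (qderiv B).
  by rewrite -qderivM; exact: eqX_qderiv.
have -> : A * B * qderiv ph =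
    (qderiv ph * A + ph * qderiv A) * B - ph * (qderiv A * B) by ring.
(* The inserted products cancel; they give this side the shape that the other side takes below, so
   that [tAB] closes the gap. *)
have -> : A * B * (- 2 * lambert odd_term N * ph) =
  (ph * A) * qderiv B - (ph * A) * qderiv B - ph * (2 * lambert odd_term N * (A * B)) by ring.
apply: (@eqX_trans _ _ (qderiv B * B - ph * (qderiv A * B))).
  apply: eqXD; last exact: eqX_refl.
  by apply: eqXM.
apply: (@eqX_trans _ _ ((ph * A) * qderiv B - ph * (qderiv A * B))).
  apply: eqXD; last exact: eqX_refl.
  by rewrite mulrC; apply: eqXM => //; exact: eqX_sym.
have -> : (ph * A) * qderiv B - ph * (qderiv A * B) =
   (ph * A) * qderiv B - (ph * A) * qderiv B - ph * (qderiv A * B - A * qderiv B) by ring.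
by apply: eqXD => //; apply/eqXN/eqXMl.
Qed.

Lemma coef0_theta_neg N : (theta_neg int N)`_0 = 1.
Proof.
rewrite coefD coef1 coef_sum big1_seq ?addr0// => j.
rewrite mem_index_iota => /andP[_ /andP[j0 _]]; rewrite coefMXn.
by rewrite expn_gt0 j0.
Qed.

Lemma jacobi_eight_squares N :
  eqX N (theta_neg int N ^+ 8) (1 + 16 * lambert cube_term N).
Proof.
apply: (@eqX_ode _ (- 16 * lambert odd_term N)).
- by rewrite coef0M coef0_lambert mulr0.
- rewrite -horner_coef0 horner_exp horner_coef0 coef0_theta_neg expr1n.
  by rewrite coefD coef1 coef0M coef0_lambert mulr0 addr0.
- rewrite qderivX.
  have -> : - 16 * lambert odd_term N * theta_neg int N ^+ 8 =
    8%:R * theta_neg int N ^+ 7 * (- 2 * lambert odd_term N * theta_neg int N) by ring.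
  exact/eqXMl/qderiv_theta_neg.
(* Coefficientwise, the equation for the Lambert series is 16 times [lambert_recurrence]. *)
move=> n nN; rewrite coef_qderiv.
have -> : - 16 * lambert odd_term N * (1 + 16 * lambert cube_term N) =
  - 16 * (lambert odd_term N + 16 * (lambert odd_term N * lambert cube_term N)) by ring.
have -> : (16 : {poly int}) = 16%:P by rewrite polyC_natr.
rewrite -polyCN !coefCM !coefD coefCM coef1 coefCM coef_lambertM !coef_lambert.
have := lambert_recurrence nN.
set c := \sum_(u <- box N | _) cube_term u; set s := \sum_(u <- box N | _) odd_term u.
set q := \sum_(t <- quads N | _) _ => E.
have -> : s + 16 * q = - (n%:Z * c) by lia.
clear E; clearbody c s q; case: n {nN} => [|n]; first by rewrite mulr0n; ring.
by rewrite add0r -mulr_natr natz; ring.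
Qed.

(** * Counting overpartitions and sums of squares *)

(** Shared by both counts: c = 1 for overpartitions and their triples, c = -1 for sums of squares.
    The list [L] may also hold objects of other weights. *)
Lemma coef_gf (T : choiceType) (L : seq T) (w : T -> nat) (c : int) (n : nat)
    (A : set T) :
  uniq L -> finite_set A -> (forall t, A t <-> t \in L /\ w t = n) ->
  (\sum_(t <- L) (c%:P * 'X) ^+ w t)`_n = c ^+ n * (#|` fset_set A|)%:Z.
Proof.
move=> uL finA AP.
have -> : #|` fset_set A| = count (fun t => w t == n) L.
  rewrite -size_filter; apply/perm_size/uniq_perm.
  - exact: fset_uniq.
  - exact: filter_uniq.
  move=> t; rewrite mem_filter; apply/idP/andP.
    by rewrite in_fset_set// inE => /AP[-> ->].
  by case=> /eqP wt tL; rewrite in_fset_set// inE; apply/AP.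
rewrite coef_sum -sum1_count -[in RHS](intz (Posz _)) sumMz mulr_sumr [RHS]big_mkcond.
apply: eq_bigr => t _; rewrite exprMn -polyC_exp coefCM coefXn eq_sym.
by case: eqP => [->|]; rewrite ?mulr1 ?mulr0.
Qed.

Lemma card_fset_set_image (T : choiceType) (A B C : set T) (f : T -> T) :
  finite_set A -> finite_set B -> finite_set C -> injective f ->
  (forall u, B u -> ~ A (f u)) ->
  (forall t, C t <-> A t \/ exists2 u, B u & f u = t) ->
  #|` fset_set C| = (#|` fset_set A| + #|` fset_set B|)%N.
Proof.
move=> finA finB finC injf AB CP.
rewrite -(size_map f (fset_set B)) -size_cat; apply/perm_size/uniq_perm.
- exact: fset_uniq.
- rewrite cat_uniq map_inj_uniq// !fset_uniq andbT /=.
  apply/hasPn => t /mapP[u + ->]; rewrite !in_fset_set// inE => /AB.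
  by move=> nA; apply/negP; rewrite inE.
move=> t; rewrite mem_cat !in_fset_set//; apply/idP/orP.
  case/set_mem/CP => [At|[u Bu <-]]; first by left; apply: mem_set.
  by right; apply/mapP; exists u; rewrite ?in_fset_set// mem_set.
move=> tAB; apply/mem_set/CP; case: tAB => [/set_mem|]; first by left.
by move=> /mapP[u + ->]; rewrite in_fset_set// => /set_mem Bu; right; exists u.
Qed.

Definition ov_upto (m n : nat) : set (seq (nat * bool)) :=
  [set s | [&& is_overpartition s, all (fun x => x.1 <= m)%N s & weight s == n]].

(* The sequences that may follow a part [m] in an overpartition. *)
Definition ov_after (m n : nat) : set (seq (nat * bool)) :=
  [set s | [&& all (fun x => 0 < x.1)%N s, path overpart_rel (m, false) s
             & weight s == n]].

Lemma path_overpart_flag m b b' s :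
  path overpart_rel (m, b) s = path overpart_rel (m, b') s.
Proof. by case: s. Qed.

Lemma path_overpart_le x s :
  path overpart_rel x s -> all (fun y => y.1 <= x.1)%N s.
Proof.
elim: s x => //= y s IHs x /andP[xy /IHs ys].
have yx : (y.1 <= x.1)%N.
  by case/orP: xy => [/ltnW//|/andP[/eqP->]].
by rewrite yx; apply: sub_all ys => z /leq_trans; apply.
Qed.

Lemma path_overpart_lt m b s :
  all (fun y => y.1 <= m)%N s -> sorted overpart_rel s ->
  path overpart_rel (m.+1, b) s.
Proof. by case: s => //= y s /andP[ym _] ->; rewrite /overpart_rel/= ltnS ym. Qed.

Lemma weight_cons x s : weight (x :: s) = (x.1 + weight s)%N.
Proof. by []. Qed.

Lemma finite_ov_upto m n : finite_set (ov_upto m n).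
Proof.
by apply: sub_finite_set (finite_overpartitions n) => s /= /and3P[? _ /eqP->].
Qed.

Lemma finite_ov_after m n : finite_set (ov_after m n).
Proof.
apply: sub_finite_set (finite_overpartitions n) => s /= /and3P[s0 ps /eqP->].
by rewrite /is_overpartition s0 (path_sorted ps).
Qed.

(** Either the sequence starts with an overlined m + 1, and what remains may follow m + 1, or the
    whole sequence may already follow m + 1. *)
Lemma card_ov_upto m n : #|` fset_set (ov_upto m.+1 n)| =
  (#|` fset_set (ov_after m.+1 n)| +
   (if n < m.+1 then 0 else #|` fset_set (ov_after m.+1 (n - m.+1)%N)|))%N.
Proof.
have sub s k : ov_after m.+1 k s -> all (fun x => x.1 <= m.+1)%N s.
  by move=> /and3P[_ /path_overpart_le].
case: ltnP => nm.
  rewrite addn0; congr (#|` fset_set _|); apply/seteqP; split=> s; last first.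
    move=> As; have := As; rewrite /ov_after/= => /and3P[s0 ps ws].
    by apply/and3P; split; rewrite // ?(sub _ _ As)// /is_overpartition s0 (path_sorted ps).
  move=> /and3P[/andP[s0 ss] sm ws]; apply/and3P; split=> //.
  move: nm; rewrite -(eqP ws); case: s s0 ss sm {ws} => //= x s _ -> /andP[xm _].
  by rewrite weight_cons /overpart_rel/= => xm'; rewrite (_ : (x.1 < m.+1)%N)//; lia.
apply: (@card_fset_set_image _ _ _ _ (cons (m.+1, true))).
- exact: finite_ov_after.
- exact: finite_ov_after.
- exact: finite_ov_upto.
- by move=> s t [].
- by move=> s _ /and3P[_]; rewrite /overpart_rel/= ltnn andbF.
move=> s; split.
  case/and3P=> /andP[s0 ss] sm /eqP ws.
  have [ps|nps] := boolP (path overpart_rel (m.+1, false) s).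
    by left; apply/and3P; split=> //; apply/eqP.
  right; case: s s0 ss sm ws nps => //= -[x b] s /= /andP[_ s0] ss /andP[xm _].
  rewrite weight_cons ss andbT /overpart_rel/= => ws; rewrite ltn_neqAle xm andbT negb_or.
  case: eqP => [e|]//=; case: b ss => // ss _; exists s; last by rewrite e.
  apply/and3P; split=> //; first by rewrite -e (path_overpart_flag _ _ true).
  by apply/eqP; rewrite -ws e addKn.
case=> [As|[u Au <-]].
  have /and3P[s0 ps ws] := As.
  by apply/and3P; split; rewrite // ?(sub _ _ As)// /is_overpartition s0 (path_sorted ps).
have /and3P[u0 pu /eqP wu] := Au; apply/and3P; split.
- by rewrite /is_overpartition /= u0 (path_overpart_flag _ _ false).
- by rewrite /= leqnn (sub _ _ Au).
by rewrite weight_cons wu /= subnKC.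
Qed.

(** After a part m + 1 any further m + 1 is plain; the sequence either starts with one or has all
    its parts at most m. *)
Lemma card_ov_after m n : #|` fset_set (ov_after m.+1 n)| =
  (#|` fset_set (ov_upto m n)| +
   (if n < m.+1 then 0 else #|` fset_set (ov_after m.+1 (n - m.+1)%N)|))%N.
Proof.
have sub s : ov_upto m n s -> ov_after m.+1 n s.
  move=> /and3P[/andP[s0 ss] sm ws]; apply/and3P; split=> //.
  exact: path_overpart_lt.
have after s : ov_after m.+1 n s -> ov_upto m n s \/
    exists2 u, (m.+1 <= n)%N /\ ov_after m.+1 (n - m.+1) u & (m.+1, false) :: u = s.
  case/and3P=> s0 ps /eqP ws.
  case: s s0 ps ws => [|[x b] s] /=; first by move=> _ _ ws; left; apply/and3P; rewrite ws.
  rewrite weight_cons /overpart_rel/= => /andP[x0 s0] /andP[/orP[xm|/andP[/eqP xm nb]] ps] ws.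
    left; apply/and3P; split; [|apply/andP; split=> //=|exact/eqP].
      by rewrite /is_overpartition /= x0 s0.
    apply: sub_all (path_overpart_le ps) => y /= /leq_trans; apply.
    by rewrite -ltnS.
  case: b nb ps => // _ ps; right; exists s; last by rewrite xm.
  split; first by rewrite -ws xm leq_addr.
  by apply/and3P; split; rewrite // -?xm// -ws addKn.
case: ltnP => nm.
  rewrite addn0; congr (#|` fset_set _|); apply/seteqP; split=> s; last exact: sub.
  by case/after => // -[u []]; rewrite leqNgt nm.
apply: (@card_fset_set_image _ _ _ _ (cons (m.+1, false))).
- exact: finite_ov_upto.
- exact: finite_ov_after.
- exact: finite_ov_after.
- by move=> s t [].
- by move=> s _ /and3P[_]; rewrite /overpart_rel/= ltnn.
move=> s; split.
  by case/after => [|[u [_ Au] <-]]; [left|right; exists u].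
case=> [/sub//|[u /and3P[u0 pu /eqP wu] <-]].
apply/and3P; split; rewrite /overpart_rel/= ?u0 ?pu ?ltnn ?eqxx//.
by rewrite weight_cons wu /= subnKC.
Qed.

Definition ov_gf (A : nat -> set (seq (nat * bool))) (N : nat) : {poly int} :=
  \poly_(i < N.+1) (#|` fset_set (A i)|)%:Z.

(** The two counting recurrences read V = U + q^(m+1) V and U' = (1 + q^(m+1)) V, whence (1 -
    q^(m+1)) U' = (1 + q^(m+1)) U. *)
Lemma ov_gf_prod N m :
  eqX N (prodm int 1 m.+1 * ov_gf (ov_upto m) N) (prodp int 1 m.+1).
Proof.
elim: m => [|m IHm].
  rewrite /prodm /prodp !big_geq// mul1r => i iN.
  rewrite coef_poly ltnS iN coef1; case: i {iN} => [|i].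
    rewrite (_ : ov_upto 0 0 = [set [::]]) ?fset_set1 ?cardfs1//.
    apply/seteqP; split=> s /=; last by move=> ->.
    by case/and3P=> /andP[]; case: s => //= x s /andP[x0 _] _ /andP[]; case: (x.1) x0.
  rewrite (_ : ov_upto 0 i.+1 = set0) ?fset_set0 ?cardfs0//.
  apply/seteqP; split=> s //=.
  by case/and3P=> /andP[]; case: s => //= x s /andP[x0 _] _ /andP[]; case: (x.1) x0.
rewrite /prodm /prodp !(big_nat_recr m.+1)//= -/(prodm int 1 m.+1) -/(prodp int 1 m.+1).
set U := ov_gf (ov_upto m) N in IHm *; set V := ov_gf (ov_after m.+1) N.
have V1 : eqX N V (U + 'X^(m.+1) * V).
  move=> i iN; rewrite coefD coefXnM !coef_poly ltnS iN card_ov_after.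
  by case: ltnP => // im; rewrite ltnS (leq_trans (leq_subr _ _) iN) PoszD.
have V2 : eqX N (ov_gf (ov_upto m.+1) N) (V + 'X^(m.+1) * V).
  move=> i iN; rewrite coefD coefXnM !coef_poly ltnS iN card_ov_upto.
  by case: ltnP => // im; rewrite ltnS (leq_trans (leq_subr _ _) iN) PoszD.
apply: (eqX_trans (eqXMl _ V2)).
set Y := 'X^(m.+1) in V1 V2 *; set B := prodm _ _ _.
have -> : B * (1 - Y) * (V + Y * V) = B * (1 + Y) * (V - Y * V) by ring.
apply: (@eqX_trans _ _ (B * (1 + Y) * (U + Y * V - Y * V))).
  by apply/eqXMl/eqXD.
have -> : B * (1 + Y) * (U + Y * V - Y * V) = B * U * (1 + Y) by ring.
exact: eqXM.
Qed.

Lemma ov_gf_theta_neg N :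
  eqX N (ov_gf (ov_upto N) N * theta_neg int N) 1.
Proof.
apply: (@eqX_cancel _ _ (prodp int 1 N.+1)); first exact: coef0_prodp.
rewrite mulrC -mulrA mulr1; apply: (@eqX_trans _ _ (ov_gf (ov_upto N) N * prodm int 1 N.+1)).
  by apply: eqXMl; exact: theta_neg_prod.
by rewrite mulrC; exact: ov_gf_prod.
Qed.

Lemma all_le_weight s : all (fun x => x.1 <= weight s)%N s.
Proof.
elim: s => //= x s IHs; rewrite weight_cons leq_addr /=.
by apply: sub_all IHs => y /leq_trans; apply; apply: leq_addl.
Qed.

Lemma coef_overp3 N n : (n <= N)%N ->
  (ov_gf (ov_upto N) N ^+ 3)`_n = (overp3 n)%:Z.
Proof.
move=> nN; pose O := enum_fset (fset_set [set s | is_overpartition s /\ weight s <= N])%N.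
have memO s : s \in O <-> is_overpartition s /\ (weight s <= N)%N.
  rewrite in_fset_set; last exact: finite_overpartitions.
  by split=> [/set_mem|?]; last exact: mem_set.
have uO : uniq O by exact: fset_uniq.
pose U : {poly int} := \sum_(s <- O) (1%:P * 'X) ^+ weight s.
(* Up to weight N the bound N on the parts holds automatically. *)
have UE : eqX N (ov_gf (ov_upto N) N) U.
  move=> i iN; rewrite coef_poly ltnS iN.
  rewrite (@coef_gf _ _ _ _ _ (ov_upto N i)) ?expr1n ?mul1r//.
    exact: finite_ov_upto.
  move=> s; split.
    by case/and3P=> os _ /eqP ws; split=> //; apply/memO; split=> //; rewrite ws.
  case=> /memO[os wsN] ws; apply/and3P; split=> //; last exact/eqP.
  by apply: sub_all (all_le_weight s) => x /leq_trans; apply.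
rewrite (eqXX 3 UE)//.
pose L := [seq (st, u) | st <- [seq (s, t) | s <- O, t <- O], u <- O].
have -> : U ^+ 3 = \sum_(x <- L) (1%:P * 'X) ^+
    (weight x.1.1 + weight x.1.2 + weight x.2)%N.
  rewrite !exprS expr0 mulr1 mulrA big_allpairs big_allpairs big_distrlr /=.
  rewrite mulr_suml; apply: eq_bigr => s _; rewrite mulr_suml; apply: eq_bigr => t _.
  by rewrite mulr_sumr; apply: eq_bigr => u _; rewrite !exprD.
rewrite (@coef_gf _ _ _ _ _ (overpartition_triples n)) ?expr1n ?mul1r//.
- by rewrite !allpairs_uniq => // -[? ?] [? ?].
- exact: finite_overpartition_triples.
move=> [[s t] u]; split=> [[/= os ot ou w]|[]].
  by split=> //; apply/allpairsP; exists ((s, t), u); split=> //=;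
    [apply/allpairsP; exists (s, t); split=> //=|]; apply/memO; split=> //; lia.
move=> /allpairsP[[st u'] [/= /allpairsP[[s' t'] [/= sO tO ->]] uO' [-> -> ->]]] w.
by split=> //=; [case/memO: sO|case/memO: tO|case/memO: uO'].
Qed.

(** A finite type enumerating the integers of absolute value at most N; the shift in the second
    summand keeps 0 from occurring twice. *)
Definition signed (N : nat) (j : 'I_N.+1 + 'I_N) : int :=
  match j with inl i => i%:Z | inr i => - (i.+1%:Z) end.

Lemma signed_inj N : injective (@signed N).
Proof.
move=> [i|i] [j|j] /= ij; try by exfalso; lia.
  by congr inl; apply: val_inj => /=; lia.
by congr inr; apply: val_inj => /=; lia.
Qed.

Lemma signed_onto N (z : int) : (`|z| <= N)%N -> exists j, @signed N j = z.
Proof.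
case: z => m /= mN; first by exists (inl (Ordinal (mN : (m < N.+1)%N))).
by exists (inr (Ordinal mN)); rewrite NegzE.
Qed.

Lemma theta_neg_signed N :
  theta_neg int N =
  \sum_(j : 'I_N.+1 + 'I_N) ((-1)%:P * 'X) ^+ (`|signed j| ^ 2)%N.
Proof.
(* The sign (-1)^j equals (-1)^(j^2), so phi(q) is the theta series evaluated at -q. *)
have sq (j : nat) : ((-1)%:P * 'X) ^+ (j ^ 2) = (-1) ^+ j * 'X^(j ^ 2) :> {poly int}.
  by rewrite exprMn polyCN polyC1 -[in LHS]signr_odd oddX signr_odd.
rewrite big_sumType /= big_ord_recl /= expr0 -addrA; congr (_ + _).
rewrite big_add1 big_mkord -big_split; apply: eq_bigr => i _ /=.
by rewrite ?abszN /bump leq0n add1n !sq; ring.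
Qed.

(** Expanding the power gives a sum over k-tuples with entries bounded by N. No representation of n
    is lost, since |x_i| <= x_i^2 <= n <= N. *)
Lemma coef_theta_neg_exp N k n : (n <= N)%N ->
  (theta_neg int N ^+ k)`_n = (-1) ^+ n * (rsq k n)%:Z.
Proof.
move=> nN.
pose v (f : {ffun 'I_k -> 'I_N.+1 + 'I_N}) : {ffun 'I_k -> int} :=
  [ffun i => signed (f i)].
pose L := [seq v f | f <- index_enum {ffun 'I_k -> 'I_N.+1 + 'I_N}].
have -> : theta_neg int N ^+ k =
    \sum_(x <- L) ((-1)%:P * 'X) ^+ (\sum_(i < k) `|x i| ^ 2)%N.
  rewrite theta_neg_signed -[X in _ ^+ X]card_ord -prodr_const.
  rewrite bigA_distr_bigA /= big_map; apply: eq_bigr => f _.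
  rewrite expr_sum.
  by apply: eq_bigr => i _; rewrite ffunE.
rewrite (@coef_gf _ _ _ _ _ (sum_squares_reps k n))//.
- rewrite map_inj_uniq ?index_enum_uniq// => f g /ffunP fg.
  by apply/ffunP => i; have := fg i; rewrite !ffunE => /signed_inj.
- exact: finite_sum_squares_reps.
have sumE (x : {ffun 'I_k -> int}) :
    \sum_(i < k) x i ^+ 2 = (\sum_(i < k) `|x i| ^ 2)%N%:Z.
  rewrite -natz natr_sum; apply: eq_bigr => i _.
  by rewrite natz -mulnn PoszM abszE -expr2 real_normK ?num_real.
move=> x; rewrite /sum_squares_reps /= sumE; split=> [[xn]|[_ ->]//].
split=> //; have xN i : (`|x i| <= N)%N.
  apply: leq_trans nN; rewrite -xn (bigD1 i)//=.
  by apply: leq_trans (leq_addr _ _); case: `|x i|%N => // m; rewrite -mulnn leq_pmulr.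
have h i := cid (signed_onto (xN i)).
apply/mapP; exists [ffun i => sval (h i)]; first exact: mem_index_enum.
by apply/ffunP => i; rewrite !ffunE (svalP (h i)).
Qed.

(** * Reduction modulo 11 *)

Lemma eqX_map (R S : nzRingType) (f : {rmorphism R -> S}) N (p q : {poly R}) :
  eqX N p q -> eqX N (map_poly f p) (map_poly f q).
Proof. by move=> pq i iN; rewrite !coef_map pq. Qed.

Lemma lambert_cube_mod11 N m : (11 * m <= N)%N ->
  (\sum_(u <- box N | (u.1 * u.2 == 11 * m)%N) cube_term u)%:~R =
  (\sum_(u <- box N | (u.1 * u.2 == m)%N) cube_term u)%:~R :> 'F_11.
Proof.
move=> mN.
have reduce k : (\sum_(u <- box N | (u.1 * u.2 == k)%N) cube_term u)%:~R =
    (\sum_(u <- box N | (u.1 * u.2 == k)%N && ~~ (11 %| u.1)%N) cube_term u)%:~R :> 'F_11.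
  rewrite (bigID (fun u => 11 %| u.1)%N) /= intrD [X in X + _](_ : _ = 0) ?add0r//.
  rewrite rmorph_sum big1// => u /andP[_ /dvdnP[d ud]].
  rewrite /cube_term ud rmorphM rmorphXn /= PoszM intrM.
  by rewrite [X in _ * (_ * X) ^+ 3](_ : _ = 0) ?mulr0 ?expr0n ?mulr0//; apply/eqP.
rewrite !reduce; congr (_%:~R).
rewrite -big_filter -[RHS]big_filter.
(* For a prime to 11, a x = 11 m forces 11 to divide x; the weight of 11 y is that of y because 11
   is odd. *)
transitivity (\sum_(u <- [seq (u.1, (11 * u.2)%N) | u <-
    [seq u <- box N | (u.1 * u.2 == m)%N & ~~ (11 %| u.1)%N]]) cube_term u); last first.
  by rewrite big_map; apply: eq_bigr => u _; rewrite /cube_term /cube_weight /= oddM.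
apply/perm_big/uniq_perm; first by rewrite filter_uniq ?box_uniq.
  rewrite map_inj_uniq ?filter_uniq ?box_uniq//.
  by move=> [a x] [b y] [-> e]; congr pair; lia.
move=> [a x]; apply/idP/mapP.
  rewrite mem_filter mem_box /= => /andP[/andP[/eqP ax a11]] /andP[/andP[a0 aN] /andP[x0 xN]].
  have : (11 %| a * x)%N by rewrite ax dvdn_mulr.
  rewrite Euclid_dvdM// (negPf a11) /= => /dvdnP[y xy].
  have aym : (a * y)%N = m by nia.
  exists (a, y); last by rewrite /= xy mulnC.
  rewrite mem_filter mem_box /= aym eqxx a11 a0 aN /=; lia.
move=> [[b y]]; rewrite !mem_filter !mem_box /= => /andP[/andP[/eqP bym b11]].
move=> /andP[/andP[b0 bN] /andP[y0 yN]] [-> ->].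
rewrite mulnCA bym eqxx b11 b0 bN /=; nia.
Qed.

(** By Frobenius and Fermat p^11 = p(X^11), so only coefficients of [r] at multiples of 11
    contribute. *)
Lemma coef_Frobenius11M (p r : {poly 'F_11}) n :
  (p ^+ 11 * r)`_(11 * n) = \sum_(i < size p) p`_i *
     (if (n < i)%N then 0 else r`_(11 * (n - i))).
Proof.
have pch : 11%N \in [pchar {poly 'F_11}] by rewrite pchar_poly pchar_Fp.
rewrite -[p in LHS]coefK poly_def -(pFrobenius_autE pch) rmorph_sum /=.
rewrite mulr_suml coef_sum; apply: eq_bigr => i _.
rewrite pFrobenius_autE exprZn -exprM mulnC.
have -> : p`_i ^+ 11 = p`_i by rewrite -[RHS]expf_card card_Fp.
by rewrite -scalerAl coefZ coefXnM ltn_pmul2l// -mulnBr.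
Qed.

Lemma theta_neg8_mod11 N m : (11 * m <= N)%N ->
  ((theta_neg int N ^+ 8)`_(11 * m))%:~R =
  ((theta_neg int N ^+ 8)`_m)%:~R :> 'F_11.
Proof.
move=> mN; have mN' : (m <= N)%N by apply: leq_trans mN; rewrite leq_pmull.
rewrite !(jacobi_eight_squares (N := N))// !coefD !coef1 muln_eq0 /= !intrD.
congr (_ + _); have -> : (16 : {poly int}) = 16%:P by rewrite polyC_natr.
by rewrite !coefCM !coef_lambert !intrM lambert_cube_mod11.
Qed.

Lemma overp3_mod11 n :
  (overp3 (11 * n))%:Z%:~R = ((-1) ^+ n * (rsq 7 n)%:Z)%:~R :> 'F_11.
Proof.
pose N := (11 * n)%N.
have nN : (n <= N)%N by rewrite leq_pmull.
rewrite -(coef_overp3 (leqnn N)) -(coef_theta_neg_exp 7 nN) -!(coef_map intr).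
rewrite !rmorphXn /=.
set p := map_poly _ (ov_gf _ _); set t := map_poly _ (theta_neg _ _).
have pt : eqX N (p * t) 1.
  by rewrite -rmorphM -(rmorph1 (map_poly intr)); apply/eqX_map/ov_gf_theta_neg.
have p3 : eqX N (p ^+ 3) (p ^+ 11 * t ^+ 8).
  have -> : p ^+ 11 * t ^+ 8 = p ^+ 3 * (p * t) ^+ 8 by ring.
  by rewrite -[X in eqX _ X _]mulr1 -(expr1n _ 8); apply/eqXMl/eqXX/eqX_sym.
have t7 : eqX N (t ^+ 7) (p * t ^+ 8).
  have -> : p * t ^+ 8 = t ^+ 7 * (p * t) by ring.
  by rewrite -[X in eqX _ X _]mulr1; apply/eqXMl/eqX_sym.
(* Both sides become sums of p_i times a coefficient of t^8, at 11 (n - i) on the left and at n - i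
   on the right. *)
rewrite p3// t7// coef_Frobenius11M -[p in RHS]coefK poly_def mulr_suml coef_sum.
apply: eq_bigr => i _; rewrite -scalerAl coefZ coefXnM; congr (_ * _).
case: ltnP => // ni; rewrite -!rmorphXn !coef_map /= theta_neg8_mod11//.
by rewrite leq_mul2l leq_subr orbT.
Qed.

Local Close Scope ring_scope.
Local Close Scope classical_set_scope.

Theorem theorem4p7 (n : nat) :
  ((overp3 (11 * n))%:Z = ((-1) ^+ n * (rsq 7 n)%:Z)%R %[mod 11])%Z.
Proof.
apply/eqP; rewrite eqz_mod_dvd (dvdz_pcharf (pchar_Fp (isT : prime 11))).
by rewrite intrD rmorphN subr_eq0 /= overp3_mod11.
Qed.
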